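(* Let $g\sim(a,b,\mu)$ be a Bernstein function and $r=r[g]$. For $t>0$ let $\mathcal C_t(z):=\frac{1-e^{-tz}}{tz}$. Then $\mathcal C_t\cdot g\in\mathcal W^+(\mathbb C_+)$ for each $t>0$ and \[\|\mathcal C_t\,g\|_{\mathcal W^+}=2r(t)\qquad(t>0).\]
   Context: A Bernstein function $g\sim(a,b,\mu)$ is $g(z)=a+bz+\int_{(0,\infty)}(1-e^{-sz})\mu(\mathrm ds)$ with $a,b\ge0$, $\mu$ positive Radon on $(0,\infty)$, $\int\frac{s}{1+s}\mu(\mathrm ds)<\infty$ (identified with its holomorphic extension to $\mathbb C_+=\{\operatorname{Re}z>0\}$). Its rate function is $r[g](t):=\frac a2+\frac bt+\int_{(0,\infty)}\min(s/t,1)\,\mu(\mathrm ds)$ for $t>0$. $\mathcal W^+(\mathbb C_+)$ is the Banach algebra of Laplace transforms $\hat\nu(z)=\int_{[0,\infty)}e^{-sz}\nu(\mathrm ds)$ of bounded complex Radon measures $\nu$ on $[0,\infty)$, with $\|\hat\nu\|_{\mathcal W^+}=|\nu|([0,\infty))$. *)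

(* Defs.v *)
From HB Require Import structures.
From mathcomp Require Import all_boot all_order all_algebra.
Import Order.TTheory GRing.Theory Num.Theory.
From mathcomp Require Import all_classical all_reals all_analysis.
From mathcomp Require Import complex.
Set Implicit Arguments. Unset Strict Implicit. Unset Printing Implicit Defensive.
Local Open Scope classical_set_scope.
Local Open Scope ring_scope.

Section BernsteinDefs.
Variable R : realType.

Local Notation C := R[i].
Definition cRe (z : C) : R := complex.Re z.
Definition cIm (z : C) : R := complex.Im z.

Definition cexpm (s : R) (z : C) : C :=
  Complex (expR (- (s * cRe z)) * cos (s * cIm z))
          (- (expR (- (s * cRe z)) * sin (s * cIm z))).

Definition Cplus : set C := [set z | 0 < cRe z].

Definition cint (mu : {measure set R -> \bar R}) (D : set R) (f : R -> C) : C :=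
  Complex (Rintegral mu D (fun s => cRe (f s))) (Rintegral mu D (fun s => cIm (f s))).

Definition bernstein (a b : R) (mu : {measure set R -> \bar R}) (z : C) : C :=
  (a%:C)%C + (b%:C)%C * z + cint mu `]0, +oo[ (fun s => 1 - cexpm s z).

Definition bernstein_triple (a b : R) (mu : {measure set R -> \bar R}) : Prop :=
  [/\ 0 <= a, 0 <= b, mu `]-oo, 0]%classic = 0%E
    & mu.-integrable `]0, +oo[ (fun s => (s / (1 + s))%:E)].

Definition rate (a b : R) (mu : {measure set R -> \bar R}) (t : R) : R :=
  a / 2 + b / t + Rintegral mu `]0, +oo[ (fun s => Order.min (s / t) 1).

Definition Cfun (t : R) (z : C) : C := (1 - cexpm t z) / ((t%:C)%C * z).

(* A bounded complex Radon measure on [0,oo), given through its Jordan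
   decomposition nu = (P1 - N1) + i (P2 - N2), with P1,N1,P2,N2 finite positive
   Borel measures on R carried by [0,oo). *)
Record cmeasure := CMeasure {
  cmP1 : {finite_measure set R -> \bar R};
  cmN1 : {finite_measure set R -> \bar R};
  cmP2 : {finite_measure set R -> \bar R};
  cmN2 : {finite_measure set R -> \bar R};
  cm_supp : [/\ cmP1 `]-oo, 0[%classic = 0%E, cmN1 `]-oo, 0[%classic = 0%E,
                cmP2 `]-oo, 0[%classic = 0%E & cmN2 `]-oo, 0[%classic = 0%E] }.

Definition cmval (nu : cmeasure) (A : set R) : C :=
  Complex (fine (cmP1 nu A) - fine (cmN1 nu A)) (fine (cmP2 nu A) - fine (cmN2 nu A)).

Definition cmint (nu : cmeasure) (f : R -> C) : C :=
  let I (m : {measure set R -> \bar R}) (h : R -> R) := Rintegral m `[0, +oo[ h in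
  let u := fun s => cRe (f s) in
  let v := fun s => cIm (f s) in
  Complex (I (cmP1 nu) u - I (cmN1 nu) u - I (cmP2 nu) v + I (cmN2 nu) v)
          (I (cmP1 nu) v - I (cmN1 nu) v + I (cmP2 nu) u - I (cmN2 nu) u).

Definition laplace (nu : cmeasure) (z : C) : C := cmint nu (cexpm^~ z).

Definition totvar (nu : cmeasure) (A : set R) : \bar R :=
  ereal_sup [set x : \bar R | exists (n : nat) (F : 'I_n -> set R),
     [/\ forall k, measurable (F k),
         forall k, F k `<=` A,
         forall k l, k != l -> F k `&` F l = set0 &
         x = (\sum_(k < n) Normc.normc (cmval nu (F k)))%:E]].

End BernsteinDefs.

(* Main.v *)
Require Import Defs.
From HB Require Import structures.
From mathcomp Require Import all_boot all_order all_algebra.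
From mathcomp Require Import all_classical all_reals all_analysis.
From mathcomp Require Import measurable_realfun complex ring lra.
Import Order.TTheory GRing.Theory Num.Theory.
Import numFieldNormedType.Exports.
Local Open Scope classical_set_scope.
Local Open Scope ring_scope.

(* For s > 0, with m = min(s,t) and M = max(s,t),
     (1 - e^{-sz}) (1 - e^{-tz}) / z = (1 - e^{-Mz}) (1 - e^{-mz}) / z
       = int_{[0,m)} e^{-xz} dx - int_{[0,m)} e^{-(x+M)z} dx,
   so t C_t g is the Laplace transform of
     b delta_0 + a 1_{[0,t)} dx + int 1_{[0,m)} dx mu(ds)
       - b delta_t - int 1_{[M,M+m)} dx mu(ds).
   The positive part is carried by [0,t) and the negative part by [t,oo): the
   decomposition is a Jordan decomposition and the total variation is the sum
   of the two masses, namely (b + a t + int m dmu) + (b + int m dmu). *)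

(** * Integration against sums, scalings and restrictions of measures *)

Section measures.
Context d (T : measurableType d) (R : realType).
Local Open Scope ereal_scope.

Lemma integrable_measure_add (m1 m2 : {measure set T -> \bar R}) (D : set T)
    (f : T -> \bar R) : measurable D ->
  m1.-integrable D f -> m2.-integrable D f ->
  (measure_add m1 m2).-integrable D f.
Proof.
move=> mD /integrableP[mf f1] /integrableP[_ f2];
  apply/integrableP; split => //.
rewrite ge0_integral_measure_add//; last exact: measurableT_comp.
exact: lte_add_pinfty.
Qed.

Lemma integrable_mscale (k : {nonneg R}) (m : {measure set T -> \bar R})
    (D : set T) (f : T -> \bar R) : measurable D ->
  m.-integrable D f -> (mscale k m).-integrable D f.
Proof.
move=> mD /integrableP[mf fi]; apply/integrableP; split => //.
rewrite ge0_integral_mscale//; last exact: measurableT_comp.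
by rewrite lte_mul_pinfty.
Qed.

Lemma integral_mscale (k : {nonneg R}) (m : {measure set T -> \bar R})
    (D : set T) (f : T -> \bar R) : measurable D -> m.-integrable D f ->
  \int[mscale k m]_(x in D) f x = k%:num%:E * \int[m]_(x in D) f x.
Proof.
move=> mD fi; have mf := measurable_int _ fi.
rewrite (integralE (mscale k m)) (integralE m D f) !ge0_integral_mscale//;
  try (exact: measurable_funeneg || exact: measurable_funepos).
(* Factoring the scalar out of the difference of the two parts must avoid oo - oo; integrability
   makes the negative part finite. *)
rewrite -muleBr//; apply: fin_num_adde_defl.
rewrite fin_numN; exact: integrable_neg_fin_num.
Qed.

(** The complement of [E] is null for the restriction, so the domain may be cut down to [E], where
    both measures agree. *)
Lemma integral_mrestr (m : {measure set T -> \bar R}) (E : set T)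
    (mE : measurable E) (D : set T) (f : T -> \bar R) :
  measurable D -> (mrestr m mE).-integrable D f ->
  \int[mrestr m mE]_(x in D) f x = \int[m]_(x in D `&` E) f x.
Proof.
move=> mD fi; rewrite (@negligible_integral _ _ _ (mrestr m mE) _ (~` E))//.
- rewrite setDE setCK; apply: eq_measure_integral => A mA AE.
  by rewrite /= /mrestr setIidl// => x /AE[].
- exact: measurableC.
- by rewrite /= /mrestr setICl measure0.
Qed.

End measures.

(** * Measures obtained by spreading [mu] over the region below min(s,t), and Fubini for them *)

Section fubini.
Variables (R : realType) (mu : {sigma_finite_measure set R -> \bar R}) (t : R).
Hypothesis t0 : 0 < t.
Hypothesis mint : mu.-integrable `]0, +oo[ (fun s => (Num.min s t)%:E).

Let leb : {sigma_finite_measure set (measurableTypeR R) -> \bar R} :=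
  @lebesgue_measure R.

(** Restricting mu x Leb to this region, whose section at s > 0 is [0,m), encodes the iterated
    integral of 1_{[0,m)} dx mu(ds) as one measure on the plane. *)
Definition subgraph : set (R * R) :=
  [set p | 0 < p.1 /\ 0 <= p.2 < Num.min p.1 t].

Lemma measurable_subgraph : measurable subgraph.
Proof.
rewrite (_ : subgraph = [set p | p.2 < p.1] `&` (`]0, +oo[ `*` `[0, t[)).
  apply: measurableI; last exact: measurableX.
  have := measurable_fun_ltr (@measurable_snd _ _ R R)
    (@measurable_fst _ _ R R).
  move=> /(_ measurableT [set true] I).
  by rewrite setTI preimage_true.
apply/seteqP; split=> -[s x]; rewrite /subgraph/= !in_itv/= lt_min andbT.
  by case=> s0 /andP[x0 /andP[xs xt]]; rewrite xs s0 x0 xt.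
by case=> xs [s0 /andP[x0 xt]]; rewrite s0 x0 xs xt.
Qed.

Lemma xsection_subgraph (s : R) :
  xsection subgraph s = if 0 < s then `[0, Num.min s t[%classic else set0.
Proof.
apply/seteqP; split=> x; rewrite /xsection/= inE /subgraph/=.
  by case=> ->; rewrite /= in_itv.
by case: ifP => //= s0; rewrite in_itv.
Qed.

Lemma product_subgraph :
  (mu \x leb)%E subgraph = (\int[mu]_(s in `]0%R, +oo[) (Num.min s t)%:E)%E.
Proof.
rewrite /product_measure1 [RHS]integral_mkcond; apply: eq_integral => s _.
rewrite /= xsection_subgraph patchE mem_setE in_itv/= andbT.
case: ifPn => s0; last by rewrite measure0.
by rewrite lebesgue_measure_itv/= lte_fin lt_min s0 t0 sube0.
Qed.

Lemma product_subgraph_lty : ((mu \x leb)%E subgraph < +oo)%E.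
Proof.
by rewrite product_subgraph ltey_eq (integrable_fin_num _ mint).
Qed.


Definition subgraph_measure : {measure set (R * measurableTypeR R) -> \bar R} :=
  mrestr (mu \x leb)%E measurable_subgraph.

Section spread.
Variable phi : R * measurableTypeR R -> R.
Hypothesis mphi : measurable_fun setT phi.

(* [A |-> int_(0,oo) Leb {x in [0, min(s,t)) | phi(s,x) in A} mu(ds)]; the
   instance is named because its measurability argument cannot be inferred. *)
Definition spread : {measure set R -> \bar R} :=
  measure_function_pushforward__canonical__measure_function_Measure
    subgraph_measure mphi.

Lemma spread0 (A : set R) :
  (forall s x, 0 < s -> 0 <= x < Num.min s t -> ~ A (phi (s, x))) ->
  spread A = 0%E.
Proof.
move=> phiA; rewrite /= /pushforward /mrestr (_ : _ `&` _ = set0) ?measure0//.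
by apply/seteqP; split=> // -[s x] [/=] /[swap] -[s0 xs]; exact: phiA.
Qed.

(** The preimage of [A] contains the whole subgraph, so the mass is that of the subgraph whatever
    [phi] is. Hence both halves of the decomposition contribute the same int m dmu. *)
Lemma spreadT (A : set R) :
  (forall s x, 0 < s -> 0 <= x < Num.min s t -> A (phi (s, x))) ->
  spread A = (\int[mu]_(s in `]0%R, +oo[) (Num.min s t)%:E)%E.
Proof.
move=> phiA; rewrite /= /pushforward /mrestr -product_subgraph; congr (_ _).
by apply/seteqP; split=> [p [//]|[s x] [s0 xs]]; split=> //; exact: phiA.
Qed.

Variable f : R -> R.
Hypothesis mf : measurable_fun setT f.
Hypothesis phi0 : forall s x, 0 < s -> 0 <= x < Num.min s t -> 0 <= phi (s, x).
Hypothesis fb : exists M, forall x, 0 <= x -> `|f x| <= M.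

Let F (s : R) := \int[leb]_(x in `[0, Num.min s t[) f (phi (s, x)).

(** Extension by zero to the whole plane, where Fubini is applied. *)
Let restr_fun := ((f \o phi) \_ subgraph).

Let integrable_comp : (mu \x leb)%E.-integrable subgraph (EFin \o (f \o phi)).
Proof.
apply: measurable_bounded_integrable.
- exact: measurable_subgraph.
- exact: product_subgraph_lty.
- by apply: measurable_funTS; exact: measurableT_comp.
- have [M fM] := fb; exists M; split; first exact: num_real.
  by move=> y My [s x] [s0 xs]; apply: le_trans (ltW My); apply/fM/phi0.
Qed.

Let integrable_restr : (mu \x leb)%E.-integrable setT (EFin \o restr_fun).
Proof.
rewrite -restrict_EFin; apply/integrable_restrict => //.
  exact: measurable_subgraph.
by rewrite setTI.
Qed.

(** Identifies the marginal that Fubini produces from the zero extension: it is [F] on (0,oo) and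
    vanishes elsewhere, where the section is empty. *)
Let FE (s : R) : (fubini_F leb (EFin \o restr_fun) s =
  ((EFin \o F) \_ `]0%R, +oo[) s)%E.
Proof.
rewrite /fubini_F patchE mem_setE in_itv/= andbT; case: ifPn => s0; last first.
  apply: integral0_eq => x _; rewrite /restr_fun /= patchE ifF//.
  by apply/negP; rewrite inE => -[/=]; rewrite (negbTE s0).
(* [F] is a real-valued integral, with default 0 if infinite; finiteness holds as a bounded function
   is integrated over an interval of finite length. *)
rewrite fineK; last first.
  apply: integrable_fin_num => //; apply: measurable_bounded_integrable => //.
  - rewrite /= lebesgue_measure_itv/= lte_fin lt_min s0 t0.
    by rewrite -EFinB ltry.
  - apply: measurable_funTS; apply: measurableT_comp => //.
    by apply: measurableT_comp => //; exact: pair1_measurable.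
  - have [M fM] := fb; exists M; split; first exact: num_real.
    move=> y My x /=; rewrite in_itv => xs.
    by apply: le_trans (ltW My); apply/fM/phi0.
rewrite [RHS]integral_mkcond; apply: eq_integral => x _ /=.
rewrite /restr_fun /= !patchE mem_setE in_itv /=.
case: ifPn => xs.
  by move: xs; rewrite inE => -[_ /= ->].
rewrite ifF//; apply/negP => xs'; move/negP: xs; apply.
by rewrite inE; split.
Qed.

Lemma integrable_spread : mu.-integrable `]0, +oo[ (EFin \o F).
Proof.
apply/integrable_mkcond => //.
apply: eq_integrable (integrable_fubini_F integrable_restr) => //.
Qed.

(** Change of variables along [phi], then Fubini on the subgraph. *)
Lemma Rintegral_spread :
  \int[spread]_(x in `[0, +oo[) f x = \int[mu]_(s in `]0, +oo[) F s.
Proof.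
have mphi0 : measurable (phi @^-1` `[0, +oo[).
  by rewrite -[X in measurable X]setTI; exact: mphi.
have ifphi : subgraph_measure.-integrable (phi @^-1` `[0, +oo[)
    (EFin \o (f \o phi)).
  apply: measurable_bounded_integrable => //.
  - apply: le_lt_trans product_subgraph_lty.
    by apply: measureIr => //; exact: measurable_subgraph.
  - by apply: measurable_funTS; exact: measurableT_comp.
  - have [M fM] := fb; exists M; split; first exact: num_real.
    move=> y My p /=; rewrite in_itv/= andbT => p0.
    by apply: le_trans (ltW My); exact: fM.
congr fine; rewrite integral_pushforward//; last exact/measurable_EFinP.
(* Since [phi] is nonnegative on the subgraph, the constraint phi >= 0 cuts nothing off. *)
rewrite integral_mrestr// (_ : _ `&` _ = subgraph); last first.
  apply/seteqP; split=> [p []//|[s x] /[dup] sx [s0 xs]]; split=> //=.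
  by rewrite in_itv/= andbT; exact: phi0.
rewrite integral_mkcond [RHS]integral_mkcond.
under [RHS]eq_integral do rewrite -FE.
by rewrite (integral12_prod_meas1 integrable_restr) restrict_EFin.
Qed.

End spread.

End fubini.

(** * Complex-valued integrals, handled componentwise *)

Section complex_integral.
Context d (T : measurableType d) (R : realType).
Implicit Types (m : {measure set T -> \bar R}) (D : set T) (f g : T -> R[i]).
Local Notation C := R[i].

(** Same shape as [cint], over an arbitrary measurable space. *)
Definition Cint m D f : C :=
  Complex (\int[m]_(x in D) cRe (f x)) (\int[m]_(x in D) cIm (f x)).

Definition cintegrable m D f :=
  m.-integrable D (fun x => (cRe (f x))%:E) /\
  m.-integrable D (fun x => (cIm (f x))%:E).

Lemma eq_Cint m D f g : {in D, f =1 g} -> Cint m D f = Cint m D g.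
Proof. by move=> fg; congr Complex; apply: eq_Rintegral => x /fg ->. Qed.

Lemma cRe_mul (c z : C) : cRe (c * z) = cRe c * cRe z - cIm c * cIm z.
Proof. by case: c z => [? ?] [? ?]. Qed.

Lemma cIm_mul (c z : C) : cIm (c * z) = cRe c * cIm z + cIm c * cRe z.
Proof. by case: c z => [? ?] [? ?]. Qed.

Lemma cRe_sub (c z : C) : cRe (c - z) = cRe c - cRe z.
Proof. by case: c z => [? ?] [? ?]. Qed.

Lemma cIm_sub (c z : C) : cIm (c - z) = cIm c - cIm z.
Proof. by case: c z => [? ?] [? ?]. Qed.

Lemma cRe_opp (z : C) : cRe (- z) = - cRe z.
Proof. by case: z. Qed.

Lemma cIm_opp (z : C) : cIm (- z) = - cIm z.
Proof. by case: z. Qed.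

Let integrableRZ m D (k : R) (f : T -> R) : measurable D ->
  m.-integrable D (fun x => (f x)%:E) ->
  m.-integrable D (fun x => (k * f x)%:E).
Proof. by move=> mD fi; exact: (integrableZl mD k fi). Qed.

Lemma CintZ m D (c : C) f : measurable D -> cintegrable m D f ->
  Cint m D (fun x => c * f x) = c * Cint m D f.
Proof.
move=> mD [f1 f2]; rewrite /Cint.
under eq_Rintegral do rewrite cRe_mul.
under [X in Complex _ X]eq_Rintegral do rewrite cIm_mul.
rewrite RintegralB// ?RintegralD//; do ?exact: integrableRZ.
by rewrite !RintegralZl//; case: c.
Qed.

Lemma cintegrableB m D f g : measurable D ->
  cintegrable m D f -> cintegrable m D g ->
  cintegrable m D (fun x => f x - g x).
Proof.
move=> mD [f1 f2] [g1 g2]; split.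
  under eq_fun do rewrite cRe_sub.
  exact: (integrableB mD f1 g1).
under eq_fun do rewrite cIm_sub.
exact: (integrableB mD f2 g2).
Qed.

Lemma CintB m D f g : measurable D -> cintegrable m D f -> cintegrable m D g ->
  Cint m D (fun x => f x - g x) = Cint m D f - Cint m D g.
Proof.
move=> mD [f1 f2] [g1 g2]; rewrite /Cint.
under eq_Rintegral do rewrite cRe_sub.
under [X in Complex _ X]eq_Rintegral do rewrite cIm_sub.
by rewrite !RintegralB.
Qed.

Lemma Cint_measure_add m1 m2 D f : measurable D ->
  cintegrable m1 D f -> cintegrable m2 D f ->
  Cint (measure_add m1 m2) D f = Cint m1 D f + Cint m2 D f.
Proof.
move=> mD [f1 f2] [g1 g2]; rewrite /Cint /Rintegral.
rewrite !integral_measure_add//.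
by congr Complex; rewrite fineD//; exact: integrable_fin_num.
Qed.

Lemma cintegrable_measure_add m1 m2 D f : measurable D ->
  cintegrable m1 D f -> cintegrable m2 D f ->
  cintegrable (measure_add m1 m2) D f.
Proof.
by move=> mD [f1 f2] [g1 g2]; split; exact: integrable_measure_add.
Qed.

Lemma Cint_mscale (k : {nonneg R}) m D f : measurable D -> cintegrable m D f ->
  Cint (mscale k m) D f = (k%:num%:C)%C * Cint m D f.
Proof.
move=> mD [f1 f2]; rewrite /Cint /Rintegral !integral_mscale//.
rewrite fineM//; last exact: integrable_fin_num.
rewrite fineM//; last exact: integrable_fin_num.
by apply/eqP; rewrite eq_complex/= !mul0r subr0 addr0 !eqxx.
Qed.

Lemma cintegrable_mscale (k : {nonneg R}) m D f : measurable D ->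
  cintegrable m D f -> cintegrable (mscale k m) D f.
Proof. by move=> mD [f1 f2]; split; exact: integrable_mscale. Qed.

Lemma Cint_dirac D (a : T) f : measurable D -> a \in D ->
  measurable_fun D (fun x => cRe (f x)) ->
  measurable_fun D (fun x => cIm (f x)) ->
  Cint \d_a D f = f a.
Proof.
move=> mD aD m1 m2; rewrite /Cint /Rintegral !integral_dirac//;
  [|exact/measurable_EFinP|exact/measurable_EFinP].
by rewrite diracE aD !mul1e/=; case: (f a).
Qed.

End complex_integral.
Arguments Cint {d T R}.
Arguments cintegrable {d T R}.

(** * The kernel e^{-sz}: functional equation, derivative in s, bounds and integral *)

Section exponential.
Variable R : realType.
Implicit Types (z : R[i]) (s x : R).

Lemma cexpmD s x z : cexpm (s + x) z = cexpm s z * cexpm x z.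
Proof.
apply/eqP; rewrite eq_complex /cexpm /=; set p := cRe z; set q := cIm z.
rewrite !mulrDl opprD expRD cosD sinD.
by apply/andP; split; apply/eqP; ring.
Qed.

Lemma cexpm0 z : cexpm 0 z = 1.
Proof. by rewrite /cexpm !mul0r oppr0 expR0 cos0 sin0 !mul1r oppr0. Qed.

(** With its imaginary companion this is d/ds e^{-sz} = -z e^{-sz}, split into components because
    the fundamental theorem of calculus is applied to real functions. *)
Lemma is_derive_cRe_cexpm z x :
  is_derive x 1 (fun s => cRe (cexpm s z)) (cRe (- z * cexpm x z)).
Proof.
rewrite /cexpm /=; set p := cRe z; set q := cIm z.
have dp : is_derive x 1 (fun s : R => - (s * p)) (- p).
  by apply: is_derive_eq; rewrite scaler0 add0r /GRing.scale/= mulr1.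
have dq : is_derive x 1 (fun s : R => s * q) q.
  by apply: is_derive_eq; rewrite scaler0 add0r /GRing.scale/= mulr1.
have de := @is_derive1_comp _ expR (fun s : R => - (s * p)) x _ _
  (is_derive_expR _) dp.
have dc := @is_derive1_comp _ cos (fun s : R => s * q) x _ _
  (is_derive_cos _) dq.
refine (is_derive_eq (is_deriveM de dc) _).
rewrite /GRing.scale/= -/p -/q ?cRe_mul ?cIm_mul cRe_opp cIm_opp -/p -/q /=.
ring.
Qed.

Lemma is_derive_cIm_cexpm z x :
  is_derive x 1 (fun s => cIm (cexpm s z)) (cIm (- z * cexpm x z)).
Proof.
rewrite /cexpm /=; set p := cRe z; set q := cIm z.
have dp : is_derive x 1 (fun s : R => - (s * p)) (- p).
  by apply: is_derive_eq; rewrite scaler0 add0r /GRing.scale/= mulr1.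
have dq : is_derive x 1 (fun s : R => s * q) q.
  by apply: is_derive_eq; rewrite scaler0 add0r /GRing.scale/= mulr1.
have de := @is_derive1_comp _ expR (fun s : R => - (s * p)) x _ _
  (is_derive_expR _) dp.
have ds := @is_derive1_comp _ sin (fun s : R => s * q) x _ _
  (is_derive_sin _) dq.
refine (is_derive_eq (is_deriveN (is_deriveM de ds)) _).
rewrite /GRing.scale/= -/p -/q ?cRe_mul ?cIm_mul cRe_opp cIm_opp -/p -/q /=.
ring.
Qed.

Lemma continuous_cRe_cexpm z : continuous (fun s => cRe (cexpm s z)).
Proof.
move=> x; apply/differentiable_continuous/derivable1_diffP.
by have [] := is_derive_cRe_cexpm z x.
Qed.

Lemma continuous_cIm_cexpm z : continuous (fun s => cIm (cexpm s z)).
Proof.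
move=> x; apply/differentiable_continuous/derivable1_diffP.
by have [] := is_derive_cIm_cexpm z x.
Qed.

Lemma continuous_cReM_cexpm c z : continuous (fun s => cRe (c * cexpm s z)).
Proof.
rewrite (_ : (fun _ => _) = fun s =>
    cRe c * cRe (cexpm s z) - cIm c * cIm (cexpm s z)); last first.
  by apply/funext => s; rewrite cRe_mul.
by move=> x; apply: cvgB; apply: cvgMr;
  [exact: continuous_cRe_cexpm|exact: continuous_cIm_cexpm].
Qed.

Lemma continuous_cImM_cexpm c z : continuous (fun s => cIm (c * cexpm s z)).
Proof.
rewrite (_ : (fun _ => _) = fun s =>
    cRe c * cIm (cexpm s z) + cIm c * cRe (cexpm s z)); last first.
  by apply/funext => s; rewrite cIm_mul.
by move=> x; apply: cvgD; apply: cvgMr;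
  [exact: continuous_cIm_cexpm|exact: continuous_cRe_cexpm].
Qed.

Lemma measurable_cRe_cexpm z : measurable_fun setT (fun s => cRe (cexpm s z)).
Proof. by apply: continuous_measurable_fun; exact: continuous_cRe_cexpm. Qed.

Lemma measurable_cIm_cexpm z : measurable_fun setT (fun s => cIm (cexpm s z)).
Proof. by apply: continuous_measurable_fun; exact: continuous_cIm_cexpm. Qed.

Lemma cRe_cexpm_le1 z s : 0 < cRe z -> 0 <= s -> `|cRe (cexpm s z)| <= 1.
Proof.
move=> z0 s0; rewrite /= normrM ger0_norm ?expR_ge0//.
rewrite -[leRHS]mulr1 ler_pM ?expR_ge0//.
  by rewrite -expR0 ler_expR oppr_le0 mulr_ge0// ltW.
by rewrite ler_norml cos_geN1 cos_le1.
Qed.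

Lemma cIm_cexpm_le1 z s : 0 < cRe z -> 0 <= s -> `|cIm (cexpm s z)| <= 1.
Proof.
move=> z0 s0; rewrite /= normrN normrM ger0_norm ?expR_ge0//.
rewrite -[leRHS]mulr1 ler_pM ?expR_ge0//.
  by rewrite -expR0 ler_expR oppr_le0 mulr_ge0// ltW.
by rewrite ler_norml sin_geN1 sin_le1.
Qed.

(** Re e^{-sz} <= e^{-s Re z} < 1. This permits division by 1 - e^{-tz}. *)
Lemma cexpm_neq1 z s : 0 < cRe z -> 0 < s -> 1 - cexpm s z != 0.
Proof.
move=> z0 s0; apply/eqP => e1.
suff : 0 < cRe (1 - cexpm s z) by rewrite e1 ltxx.
rewrite /= subr_gt0; apply: (@le_lt_trans _ _ (expR (- (s * cRe z)))).
  by rewrite -[leRHS]mulr1 ler_wpM2l ?expR_ge0// cos_le1.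
by rewrite -expR0 ltr_expR oppr_lt0 mulr_gt0.
Qed.

(** Both components are bounded by 1 as [g] is nonnegative on [D], and [D] has finite mass. *)
Lemma cintegrable_cexpm (d : measure_display) (T : measurableType d)
    (m : {measure set T -> \bar R}) (D : set T) (g : T -> R) z :
  measurable D -> (m D < +oo)%E -> measurable_fun D g ->
  (forall u, D u -> 0 <= g u) -> 0 < cRe z ->
  cintegrable m D (fun u => cexpm (g u) z).
Proof.
move=> mD Doo mg g0 z0; split; apply: measurable_bounded_integrable => //.
- exact: (measurableT_comp (measurable_cRe_cexpm z) mg).
- exists 1; split; first exact: num_real.
  by move=> M M1 u /g0 gx0; apply: le_trans (ltW M1); exact: cRe_cexpm_le1.
- exact: (measurableT_comp (measurable_cIm_cexpm z) mg).
- exists 1; split; first exact: num_real.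
  by move=> M M1 u /g0 gx0; apply: le_trans (ltW M1); exact: cIm_cexpm_le1.
Qed.

Let leb := @lebesgue_measure R.

(** The endpoint [a] is Lebesgue-null, so the closed-interval theorem applies. *)
Let FTC2 (f F : R -> R) (a : R) : 0 < a ->
  (forall x, is_derive x 1 F (f x)) -> continuous f ->
  \int[leb]_(x in `[0, a[) f x = F a - F 0.
Proof.
move=> a0 dF cf; rewrite /Rintegral integral_itv_bndo_bndc; last first.
  apply: measurable_funTS; apply/measurable_EFinP.
  exact: continuous_measurable_fun.
rewrite (@continuous_FTC2 _ f F)//.
- exact: continuous_subspaceT.
- have cF : continuous F.
    move=> x; apply/differentiable_continuous/derivable1_diffP.
    by have [] := dF x.
  split; first by move=> x _; have [] := dF x.
    exact/cvg_at_right_filter/cF.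
  exact/cvg_at_left_filter/cF.
- by move=> x _; rewrite derive1E; have [] := dF x.
Qed.

Lemma Cint_cexpm z a : 0 < cRe z -> 0 <= a ->
  z * Cint leb `[0, a[ (fun s : R => cexpm s z) = 1 - cexpm a z.
Proof.
move=> z0; rewrite le_eqVlt => /predU1P[<-|a0].
  by rewrite set_itvco0 cexpm0 subrr /Cint !Rintegral_set0 mulr0.
(* After a change of sign the integrand is -z e^{-xz}, the derivative of e^{-xz}. *)
apply: oppr_inj; rewrite -mulNr opprB -CintZ//; last first.
  apply: cintegrable_cexpm => //.
    by rewrite /= lebesgue_measure_itv/= lte_fin a0 -EFinB ltry.
  by move=> x; rewrite /= in_itv/= => /andP[].
rewrite -(cexpm0 z) /Cint.
by rewrite
  (FTC2 _ _ _ a0 (is_derive_cRe_cexpm z) (continuous_cReM_cexpm (- z) z))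
  (FTC2 _ _ _ a0 (is_derive_cIm_cexpm z) (continuous_cImM_cexpm (- z) z)).
Qed.

End exponential.

(** * Total variation of a real measure given by mutually singular parts *)

Section total_variation.
Variable R : realType.

Lemma normc_real (x : R) : Normc.normc (Complex x 0) = `|x|.
Proof. by rewrite /Normc.normc expr0n/= addr0 sqrtr_sqr. Qed.

(** Upper bound: |P - N| <= P + N on each piece of a disjoint family in [U]. The bound is attained
    by the Hahn partition of [U] along [A]. *)
Lemma totvar_singular (nu : cmeasure R) (A U : set R) :
  measurable A -> measurable U ->
  (forall B, measurable B -> cmP2 nu B = 0%E) ->
  (forall B, measurable B -> cmN2 nu B = 0%E) ->
  cmP1 nu (U `\` A) = 0%E -> cmN1 nu (U `&` A) = 0%E ->
  totvar nu U = (cmP1 nu U + cmN1 nu U)%E.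
Proof.
move=> mA mU P2 N2 PA NA.
have normE B : measurable B ->
    Normc.normc (cmval nu B) = `|fine (cmP1 nu B) - fine (cmN1 nu B)|.
  by move=> mB; rewrite /cmval P2// N2// subrr normc_real.
have fP B : measurable B -> cmP1 nu B \is a fin_num by exact: fin_num_measure.
have fN B : measurable B -> cmN1 nu B \is a fin_num by exact: fin_num_measure.
apply/eqP; rewrite eq_le; apply/andP; split.
  apply: ge_ereal_sup => _ [n [F [mF FU tF ->]]].
  have le_sum (m : {measure set R -> \bar R}) : (\sum_(k < n) m (F k) <= m U)%E.
    have mUF : measurable (\big[setU/set0]_(k < n) F k).
      by apply: bigsetU_measurable => k _; exact: mF.
    rewrite -measure_semi_additive_ord//; last first.
      by apply/trivIsetP => k l _ _; exact: tF.
    apply: le_measure; rewrite ?inE//.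
    apply: (big_ind (fun X => X `<=` U)) => // X Y XU YU.
    by rewrite subUset.
  apply: le_trans (leeD (le_sum (cmP1 nu)) (le_sum (cmN1 nu))).
  rewrite (eq_bigr _ (fun k _ => normE _ (mF k))) -big_split /= -sumEFin.
  apply: lee_sum => k _; rewrite -[X in (_ <= X + _)%E]fineK ?fP//.
  rewrite -[X in (_ <= _ + X)%E]fineK ?fN//.
  rewrite -EFinD lee_fin (le_trans (ler_normB _ _))//.
  by rewrite !ger0_norm// fine_ge0.
apply: ereal_sup_ubound.
(* On the first piece the negative part vanishes, on the second the positive part, so no
   cancellation occurs. *)
exists 2%N, (fun k : 'I_2 => if val k == 0%N then U `&` A else U `\` A).
have mI : measurable (U `&` A) by exact: measurableI.
have mD : measurable (U `\` A) by exact: measurableD.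
split.
- by move=> k; case: ifP.
- by move=> k; case: ifP => _ x [].
- have ID0 : U `&` A `&` (U `\` A) = set0.
    by apply/seteqP; split=> // x [[_ Ax] []].
  move=> [[|[|//]] k2] [[|[|//]] l2] kl /=; rewrite ?ID0 1?setIC ?ID0//;
    by case/eqP: kl; exact: val_inj.
- rewrite big_ord_recl big_ord1 !normE//= PA NA/= subr0 sub0r normrN.
  rewrite !ger0_norm ?fine_ge0//.
  rewrite EFinD !fineK ?fP ?fN//.
  have PU : cmP1 nu U = cmP1 nu (U `&` A).
    by rewrite -[RHS]add0e -PA; exact: (measureDI (cmP1 nu)).
  have NU : cmN1 nu U = cmN1 nu (U `\` A).
    by rewrite -[RHS]adde0 -NA; exact: (measureDI (cmN1 nu)).
  by rewrite PU NU.
Qed.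

End total_variation.

(** * Integrability of min(s,t) and sigma-finiteness of [mu] *)

Section bernstein.
Variables (R : realType) (mu : {measure set R -> \bar R}).

(** Domination by (1 + t) s/(1 + s): with m = min(s,t), m (1 + s) = m + m s <= s + t s. *)
Lemma integrable_min (t : R) : 0 < t ->
  mu.-integrable `]0, +oo[ (fun s => (s / (1 + s))%:E) ->
  mu.-integrable `]0, +oo[ (fun s => (Num.min s t)%:E).
Proof.
move=> t0 hmu.
have := integrableZl (measurable_itv `]0, +oo[) (1 + t) hmu.
apply: le_integrable => //.
  apply/measurable_EFinP/measurable_funTS.
  exact: measurable_minr.
move=> s; rewrite /= in_itv/= andbT => s0.
rewrite lee_fin !ger0_norm; last 2 first.
- by rewrite !mulr_ge0 ?invr_ge0 ?addr_ge0// ltW.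
- by rewrite le_min !ltW.
rewrite mulrA ler_pdivlMr ?addr_gt0//.
have m1 : Num.min s t <= s by rewrite ge_min lexx.
have m2 : Num.min s t <= t by rewrite ge_min lexx orbT.
nra.
Qed.

(** Fubini needs sigma-finiteness. As (-oo,0] is null, it is enough that [mu] is finite away from 0,
    which follows by a Markov inequality. *)
Lemma sigma_finite_of_integrable_min :
  mu `]-oo, 0]%classic = 0%E ->
  (forall t, 0 < t -> mu.-integrable `]0, +oo[ (fun s => (Num.min s t)%:E)) ->
  sigma_finite setT mu.
Proof.
move=> mu0 mint.
exists (fun n => `]-oo, 0] `|` `[n.+1%:R^-1, +oo[).
  apply/esym/seteqP; split=> // s _.
  have [s0|s0] := leP s 0.
    by exists 0%N => //; left; rewrite /= in_itv.
  (* With n the integer part of 1/s, 1/s < n + 1, hence 1/(n+1) <= s. *)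
  exists (Num.truncn s^-1) => //; right; rewrite /= in_itv/= andbT.
  rewrite -[leRHS]invrK lef_pV2 ?posrE ?invr_gt0//.
  by rewrite ltW// truncnS_gt.
move=> n; split; first exact: measurableU.
pose A : set R := `[n.+1%:R^-1, +oo[%classic.
have mA : measurable A by exact: measurable_itv.
suff Aoo : (mu A < +oo)%E.
  rewrite (le_lt_trans (measureU2 _ _ _))//= mu0 add0e; exact: Aoo.
have e0 : 0 < n.+1%:R^-1 :> R by rewrite invr_gt0.
rewrite ltey; apply/negP => /eqP muoo.
(* Put e = 1/(n+1). On [e,oo) the integrand min(s,e) is the constant e > 0, so infinite mass there
   would make its finite integral infinite. *)
have /integrableP[mf] := mint _ e0; rewrite ltNge => /negP; apply.
apply: (@le_trans _ _ (\int[mu]_(s in A) (n.+1%:R^-1)%:E)%E).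
  by rewrite integral_cst// muoo gt0_muley.
apply: (@le_trans _ _ (\int[mu]_(s in A) `|(Num.min s n.+1%:R^-1)%:E|)%E).
  apply: ge0_le_integral => //.
  - apply: measurableT_comp => //; apply: measurable_funS mf => //.
    by apply: subset_itvr; rewrite bnd_simp.
  - move=> s; rewrite /A/= in_itv/= andbT => es; rewrite lee_fin.
    by rewrite (min_idPr es) ler_norm.
apply: ge0_subset_integral => //.
- exact: measurableT_comp.
- by apply: subset_itvr; rewrite bnd_simp.
Qed.
End bernstein.

(** * Laplace integrals of the spread measures *)

Section spread_cexpm.
Variables (R : realType) (mu : {sigma_finite_measure set R -> \bar R}) (t : R).
Hypothesis t0 : 0 < t.
Hypothesis mint : mu.-integrable `]0, +oo[ (fun s => (Num.min s t)%:E).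
Variable phi : R * measurableTypeR R -> R.
Hypothesis mphi : measurable_fun setT phi.
Hypothesis phi0 : forall s x, 0 < s -> 0 <= x < Num.min s t -> 0 <= phi (s, x).
Variable z : R[i].
Hypothesis z0 : 0 < cRe z.

(** For s > 0 it is (1 - e^{-mz})/z when [phi] is [snd], and e^{-Mz} times that when [phi] is x +
    M. *)
Definition inner_laplace (s : R) : R[i] :=
  Cint (@lebesgue_measure R) `[0, Num.min s t[ (fun x => cexpm (phi (s, x)) z).

Let bRe : exists M, forall x, 0 <= x -> `|cRe (cexpm x z)| <= M.
Proof. by exists 1 => x x0; exact: cRe_cexpm_le1. Qed.

Let bIm : exists M, forall x, 0 <= x -> `|cIm (cexpm x z)| <= M.
Proof. by exists 1 => x x0; exact: cIm_cexpm_le1. Qed.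

Lemma Cint_spread :
  Cint (spread R mu t phi mphi) `[0, +oo[ (fun x => cexpm x z) =
  Cint mu `]0, +oo[ inner_laplace.
Proof.
congr Complex.
  exact: (Rintegral_spread _ _ _ t0 mint _ mphi _
    (measurable_cRe_cexpm R z) phi0 bRe).
exact: (Rintegral_spread _ _ _ t0 mint _ mphi _
    (measurable_cIm_cexpm R z) phi0 bIm).
Qed.

Lemma cintegrable_spread : cintegrable mu `]0, +oo[ inner_laplace.
Proof.
split.
  exact: (integrable_spread _ _ _ t0 mint _ mphi _
    (measurable_cRe_cexpm R z) phi0 bRe).
exact: (integrable_spread _ _ _ t0 mint _ mphi _
    (measurable_cIm_cexpm R z) phi0 bIm).
Qed.

End spread_cexpm.

(** * Reduction to real measures, and the algebraic identities behind the decomposition *)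

Lemma laplace_real (R : realType) (nu : cmeasure R) (z : R[i]) :
  (forall A, measurable A -> cmP2 nu A = 0%E) ->
  (forall A, measurable A -> cmN2 nu A = 0%E) ->
  laplace nu z = Cint (cmP1 nu) `[0, +oo[ (fun x => cexpm x z) -
                 Cint (cmN1 nu) `[0, +oo[ (fun x => cexpm x z).
Proof.
move=> P2 N2.
have I0 (m : {measure set R -> \bar R}) (h : R -> R) :
    (forall A, measurable A -> m A = 0%E) -> Rintegral m `[0, +oo[ h = 0.
  move=> m0; rewrite /Rintegral (eq_measure_integral mzero).
    by rewrite integral_measure_zero.
  by move=> A mA _; exact: m0.
by rewrite /laplace /cmint !(I0 (cmP2 nu))// !(I0 (cmN2 nu))// !addr0 !subr0.
Qed.

Lemma inner_laplace_sub (R : realType) (s t : R) (z : R[i]) :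
  0 < cRe z -> 0 < s -> 0 < t ->
  (1 - cexpm s z) * (1 - cexpm t z) =
  z * (inner_laplace R t snd z s -
       inner_laplace R t (fun p => p.2 + Num.max p.1 t) z s).
Proof.
move=> z0 s0 t0; set g := inner_laplace R t snd z s.
have m0 : 0 <= Num.min s t by rewrite le_min !ltW.
have zg : z * g = 1 - cexpm (Num.min s t) z by exact: Cint_cexpm.
have -> : inner_laplace R t (fun p => p.2 + Num.max p.1 t) z s =
    cexpm (Num.max s t) z * g.
  rewrite -CintZ//; last first.
    apply: (cintegrable_cexpm R _ (measurableTypeR R) _ _
      (fun x => (s, x).2)) => //.
    - by rewrite /= lebesgue_measure_itv/= lte_fin lt_min s0 t0 -EFinB ltry.
    - exact: measurable_id.
    - by move=> x; rewrite /= in_itv/= => /andP[].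
  by apply: eq_Cint => x _; rewrite /= addrC cexpmD.
rewrite [RHS]mulrBr [z * (_ * g)]mulrCA zg.
(* In either order {m, M} = {s, t}, and the product is symmetric in the two. *)
by case: (leP s t) => _; ring.
Qed.

(** Here [e] stands for e^{-tz}, [q0] and [q1] for the transforms of the early and late spreads of
    [mu]; (1 - e)/z is the transform of 1_{[0,t)} dx, and z/(1 - e) (q0 - q1) is the integral part
    of g. *)
Lemma cesaro_mul_identity (F : fieldType) (a b z t e q0 q1 : F) :
  1 - e != 0 -> z != 0 -> t != 0 ->
  t^-1 * (q0 + (b + a * ((1 - e) / z))) - t^-1 * (q1 + b * e) =
  (1 - e) / (t * z) * (a + b * z + z / (1 - e) * (q0 - q1)).
Proof. by move=> e0 z0 t0; field; rewrite z0 e0 t0. Qed.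

(** * The Jordan decomposition of the representing measure, for sigma-finite [mu] *)

Section sigma_finite_case.
Variables (R : realType) (a b : R).
Variable mu : {sigma_finite_measure set R -> \bar R}.
Hypotheses (a0 : 0 <= a) (b0 : 0 <= b).
Variable t : R.
Hypothesis t0 : 0 < t.
Hypothesis mint : mu.-integrable `]0, +oo[ (fun s => (Num.min s t)%:E).

(** [early] leaves [0,m) in place and [late] translates it by M; as m <= t <= M, the images lie on
    opposite sides of t. *)
Let early : R * measurableTypeR R -> R := snd.
Let late : R * measurableTypeR R -> R := fun p => p.2 + Num.max p.1 t.

Let mearly : measurable_fun setT early. Proof. exact: measurable_snd. Qed.

Let mlate : measurable_fun setT late.
Proof.
apply: measurable_funD; first exact: measurable_snd.
by apply: measurable_maxr => //; exact: measurable_fst.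
Qed.

Let early_itv s x : 0 < s -> 0 <= x < Num.min s t -> 0 <= early (s, x) < t.
Proof. by move=> _ /andP[x0]; rewrite lt_min => /andP[_ xt]; apply/andP. Qed.

Let late_itv s x : 0 < s -> 0 <= x < Num.min s t -> t <= late (s, x).
Proof.
by move=> s0 /andP[x0 _]; rewrite /late/= ler_wpDl// le_max lexx orbT.
Qed.

Let early0 s x : 0 < s -> 0 <= x < Num.min s t -> 0 <= early (s, x).
Proof. by move=> s0 xs; case/andP: (early_itv _ _ s0 xs). Qed.

Let late0 s x : 0 < s -> 0 <= x < Num.min s t -> 0 <= late (s, x).
Proof. by move=> s0 xs; exact: le_trans (ltW t0) (late_itv _ _ s0 xs). Qed.

(** With this Dirac mass in the place of [mu], the spreading construction also yields the term a
    1_{[0,t)} dx. *)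
Let dt : {sigma_finite_measure set R -> \bar R} := \d_t.

Let mindt : dt.-integrable `]0, +oo[ (fun s => (Num.min s t)%:E).
Proof.
have mmin : measurable_fun (`]0, +oo[%classic : set R)
      (fun s : R => (Num.min s t)%:E).
  by apply/measurable_EFinP/measurable_funTS; exact: measurable_minr.
apply/integrableP; split => //.
rewrite integral_dirac//; last exact: measurableT_comp.
by rewrite diracE mem_setE in_itv/= andbT t0 mul1e ltry.
Qed.

(* [Q0], [Qd] and [Q1] are the measures with densities [int 1_{[0,m)} mu(ds)],
   [1_{[0,t)}] (since [min(t,t) = t]) and [int 1_{[M,M+m)} mu(ds)]. *)
Let Q0 := spread R mu t early mearly.
Let Q1 := spread R mu t late mlate.
Let Qd := spread R dt t early mearly.

Let it0 : 0 <= t^-1. Proof. by rewrite invr_ge0 ltW. Qed.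

(** The factor 1/t makes [P] - [N] represent C_t g itself rather than t C_t g. *)
Let P : {measure set R -> \bar R} := mscale (NngNum it0) (measure_add Q0
  (measure_add (mscale (NngNum b0) \d_(0 : R)) (mscale (NngNum a0) Qd))).
Let N : {measure set R -> \bar R} :=
  mscale (NngNum it0) (measure_add Q1 (mscale (NngNum b0) \d_t)).

Let PE A :
  (P A = (t^-1)%R%:E * (Q0 A + (b%:E * \d_(0%R : R) A + a%:E * Qd A)))%E.
Proof.
rewrite -[LHS]/((t^-1)%R%:E * measure_add Q0 (measure_add
  (mscale (NngNum b0) \d_(0%R : R)) (mscale (NngNum a0) Qd)) A)%E.
rewrite measure_addE; congr (_ * (_ + _))%E; exact: measure_addE.
Qed.

Let NE A : (N A = (t^-1)%R%:E * (Q1 A + b%:E * \d_t A))%E.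
Proof.
rewrite -[LHS]/((t^-1)%R%:E * measure_add Q1 (mscale (NngNum b0) \d_t) A)%E.
by rewrite measure_addE.
Qed.

Let M := \int[mu]_(s in `]0, +oo[) Num.min s t.

Let ME : (\int[mu]_(s in `]0%R, +oo[) (Num.min s t)%:E = M%:E)%E.
Proof. by rewrite fineK// (integrable_fin_num _ mint). Qed.

(** [P] is carried by [0,t). Allowing any superset serves both finiteness, on the whole line, and
    the total variation on [0,oo). *)
Let Pfull (A : set R) : (forall x, 0 <= x < t -> A x) ->
  (P A = (t^-1 * (M + (b + a * t)))%:E)%E.
Proof.
move=> tA; have A0 : 0 \in A by rewrite inE; apply: tA; rewrite lexx.
have mdt : (\int[dt]_(s in `]0%R, +oo[) (Num.min s t)%:E = t%:E)%E.
  rewrite integral_dirac//; last exact: measurable_int mindt.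
  by rewrite diracE mem_setE in_itv/= andbT t0 mul1e minxx.
rewrite PE (spreadT _ _ _ t0) ?(spreadT _ dt _ t0) ?ME ?mdt; last 2 first.
- by move=> s x s0 xs; exact/tA/early_itv.
- by move=> s x s0 xs; exact/tA/early_itv.
by rewrite diracE A0 mule1.
Qed.

(** Used for the support condition on (-oo,0) and for singularity on [0,oo) minus [0,t). *)
Let P0 (A : set R) : (forall x, 0 <= x < t -> ~ A x) -> P A = 0%E.
Proof.
move=> tA; have A0 : 0 \notin A.
  by apply/negP; rewrite inE; apply: tA; rewrite lexx.
rewrite PE !spread0; last 2 first.
- by move=> s x s0 xs; exact/tA/early_itv.
- by move=> s x s0 xs; exact/tA/early_itv.
by rewrite diracE (negbTE A0) !mule0 !adde0 mule0.
Qed.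

Let Nfull (A : set R) : (forall x, t <= x -> A x) ->
  (N A = (t^-1 * (M + b))%:E)%E.
Proof.
move=> tA; have At : t \in A by rewrite inE; exact: tA.
rewrite NE (spreadT _ _ _ t0) ?ME; last first.
  by move=> s x s0 xs; exact/tA/late_itv.
by rewrite diracE At mule1.
Qed.

Let N0 (A : set R) : (forall x, t <= x -> ~ A x) -> N A = 0%E.
Proof.
move=> tA; have At : t \notin A by apply/negP; rewrite inE; exact: tA.
rewrite NE spread0; last by move=> s x s0 xs; exact/tA/late_itv.
by rewrite diracE (negbTE At) !mule0 !adde0 mule0.
Qed.

Let ray_cexpm z : 0 < cRe z -> forall m : {measure set R -> \bar R},
  (m setT < +oo)%E -> cintegrable m `[0, +oo[ (fun x => cexpm x z).
Proof.
move=> z0 m moo; apply: (cintegrable_cexpm R _ R m _ (fun x => x)) => //.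
- by apply: le_lt_trans moo; apply: le_measure; rewrite ?inE.
- by move=> x; rewrite /= in_itv/= andbT.
Qed.

Let dirac_lty (x : R) : ((\d_x : {measure set R -> \bar R}) setT < +oo)%E.
Proof. by rewrite [X in (X < _)%E]diracT ltry. Qed.

Let spread_lty (m : {sigma_finite_measure set R -> \bar R}) phi
    (mphi : measurable_fun setT phi) :
  m.-integrable `]0, +oo[ (fun s => (Num.min s t)%:E) ->
  (spread R m t phi mphi setT < +oo)%E.
Proof.
by move=> mi; rewrite (spreadT _ _ _ t0)// ltey_eq (integrable_fin_num _ mi).
Qed.

Let Cint_cexpm_dirac (x : R) (z : R[i]) : 0 <= x ->
  Cint (\d_x : {measure set R -> \bar R}) `[0, +oo[ (fun x => cexpm x z) =
  cexpm x z.
Proof.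
move=> x0; rewrite Cint_dirac//.
- by rewrite mem_setE in_itv/= x0.
- by apply: measurable_funTS; exact: measurable_cRe_cexpm.
- by apply: measurable_funTS; exact: measurable_cIm_cexpm.
Qed.

Let Cint_P z : 0 < cRe z -> Cint P `[0, +oo[ (fun x => cexpm x z) =
  (t^-1)%:C%C * (Cint Q0 `[0, +oo[ (fun x => cexpm x z) +
    (b%:C%C + a%:C%C * Cint Qd `[0, +oo[ (fun x => cexpm x z))).
Proof.
move=> z0; have ce := ray_cexpm z z0.
have c0 := ce Q0 (spread_lty mu _ mearly mint).
have cd := ce Qd (spread_lty dt _ mearly mindt).
have cb := ce _ (dirac_lty 0).
rewrite [LHS]Cint_mscale//; last first.
  apply: cintegrable_measure_add => //.
  by apply: cintegrable_measure_add => //; exact: cintegrable_mscale.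
congr (_ * _); rewrite [LHS]Cint_measure_add//; last first.
  by apply: cintegrable_measure_add => //; exact: cintegrable_mscale.
congr (_ + _); rewrite [LHS]Cint_measure_add//; try exact: cintegrable_mscale.
rewrite [X in X + _]Cint_mscale// [X in _ + X]Cint_mscale//.
by rewrite Cint_cexpm_dirac// cexpm0 mulr1.
Qed.

Let Cint_N z : 0 < cRe z -> Cint N `[0, +oo[ (fun x => cexpm x z) =
  (t^-1)%:C%C * (Cint Q1 `[0, +oo[ (fun x => cexpm x z) +
    b%:C%C * cexpm t z).
Proof.
move=> z0; have ce := ray_cexpm z z0.
have c1 := ce Q1 (spread_lty mu _ mlate mint).
have cb := ce _ (dirac_lty t).
rewrite [LHS]Cint_mscale//; last first.
  by apply: cintegrable_measure_add => //; exact: cintegrable_mscale.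
congr (_ * _); rewrite [LHS]Cint_measure_add//; last exact: cintegrable_mscale.
by congr (_ + _); rewrite [LHS]Cint_mscale// Cint_cexpm_dirac// ltW.
Qed.

(** Both sides are reduced to the transforms of [Q0], [Q1] and [Qd]: the left by linearity, the
    right by dividing the product identity by 1 - e^{-tz} under the integral. *)
Lemma Cint_jordan z : 0 < cRe z ->
  Cint P `[0, +oo[ (fun x => cexpm x z) -
  Cint N `[0, +oo[ (fun x => cexpm x z) =
  Cfun t z * bernstein a b mu z.
Proof.
move=> z0; rewrite Cint_P// Cint_N//.
have K0 := cexpm_neq1 _ _ _ z0 t0.
have zn0 : z != 0 by apply: contraTneq z0 => ->; rewrite ltxx.
have tn0 : (t%:C)%C != 0 :> R[i] by rewrite fmorph_eq0 gt_eqF.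
have i0 := cintegrable_spread _ mu _ t0 mint _ mearly early0 _ z0.
have i1 := cintegrable_spread _ mu _ t0 mint _ mlate late0 _ z0.
have id := cintegrable_spread _ dt _ t0 mindt _ mearly early0 _ z0.
(* The Dirac mass evaluates the inner integral at s = t, where m = t. *)
have zQd : z * Cint Qd `[0, +oo[ (fun x => cexpm x z) = 1 - cexpm t z.
  rewrite (Cint_spread _ dt _ t0 mindt _ mearly early0 _ z0).
  rewrite Cint_dirac//.
  - by rewrite /inner_laplace minxx Cint_cexpm// ltW.
  - by rewrite mem_setE in_itv/= t0.
  - by apply/measurable_EFinP; exact: measurable_int (proj1 id).
  - by apply/measurable_EFinP; exact: measurable_int (proj2 id).
(* The integrability of [1 - e^{-sz}] in [s] comes for free: this function is a
   multiple of the difference of two integrands already known integrable. *)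
have mu1 : cint mu `]0, +oo[ (fun s => 1 - cexpm s z) =
    z / (1 - cexpm t z) * (Cint Q0 `[0, +oo[ (fun x => cexpm x z) -
                           Cint Q1 `[0, +oo[ (fun x => cexpm x z)).
  rewrite (Cint_spread _ mu _ t0 mint _ mearly early0 _ z0).
  rewrite (Cint_spread _ mu _ t0 mint _ mlate late0 _ z0).
  rewrite -CintB// -CintZ//; last exact: cintegrableB.
  apply: eq_Cint => s; rewrite mem_setE in_itv/= andbT => s0.
  rewrite mulrAC -inner_laplace_sub//.
  by rewrite mulfK.
rewrite /Cfun /bernstein mu1 (fmorphV (real_complex R)).
have -> : Cint Qd `[0, +oo[ (fun x => cexpm x z) = (1 - cexpm t z) / z.
  by rewrite -zQd mulrAC divff// mul1r.
exact: cesaro_mul_identity.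
Qed.

(** The masses of [P] and [N] are (M + b + a t)/t and (M + b)/t, with sum a + 2b/t + 2M/t = 2 r(t),
    where M = int min(s,t) dmu. *)
Lemma exists_cmeasure : exists nu : cmeasure R,
    (forall z : R[i], Cplus z ->
        laplace nu z = Cfun t z * bernstein a b mu z) /\
    totvar nu `[0, +oo[ = (2 * rate a b mu t)%:E.
Proof.
have finP : fin_num_fun P.
  by apply: lty_fin_num_fun; rewrite Pfull// ltry.
have finN : fin_num_fun N.
  by apply: lty_fin_num_fun; rewrite Nfull// ltry.
pose fP : {finite_measure set R -> \bar R} := HB.pack (Measure.sort P)
  (Measure_isFinite.Build _ _ _ (Measure.sort P) finP).
pose fN : {finite_measure set R -> \bar R} := HB.pack (Measure.sort N)
  (Measure_isFinite.Build _ _ _ (Measure.sort N) finN).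
pose fz : {finite_measure set R -> \bar R} := mzero.
have supp : [/\ fP `]-oo, 0[%classic = 0%E, fN `]-oo, 0[%classic = 0%E,
    fz `]-oo, 0[%classic = 0%E & fz `]-oo, 0[%classic = 0%E].
  split=> //.
  - by apply: P0 => x /andP[x0 _]; rewrite /= in_itv/= ltNge x0.
  - by apply: N0 => x tx; rewrite /= in_itv/= ltNge (le_trans _ tx)// ltW.
exists (CMeasure supp); split.
  move=> z z0; rewrite laplace_real//; exact: Cint_jordan.
(* [0,t) is the Hahn set: [P] vanishes off it within [0,oo), and [N] vanishes on it. *)
rewrite (totvar_singular _ _ `[0, t[)//.
- rewrite [X in (X + _)%E]Pfull; last first.
    by move=> x /andP[x0 _]; rewrite /= in_itv/= x0.
  rewrite [X in (_ + X)%E]Nfull; last first.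
    by move=> x tx; rewrite /= in_itv/= (le_trans _ tx)// ltW.
  (* min(s/t,1) = min(s,t)/t, so 1/t leaves the integral in the rate. *)
  have -> : rate a b mu t = a / 2 + b / t + t^-1 * M.
    rewrite /rate /M -RintegralZl//; congr (_ + _).
    apply: eq_Rintegral => s _; rewrite minr_pMr//.
    by rewrite mulVf ?gt_eqF// mulrC.
  rewrite -EFinD; congr EFin; field.
  by rewrite gt_eqF.
- by apply: P0 => x xt [_]; apply; rewrite /= in_itv.
- apply: N0 => x tx [_]; rewrite /= in_itv/= => /andP[_].
  by rewrite ltNge tx.
Qed.

End sigma_finite_case.

(** * Passage from a general [mu] to the sigma-finite case *)

Theorem theorem3p1 (R : realType) (a b : R) (mu : {measure set R -> \bar R})
  (hg : bernstein_triple a b mu) (t : R) (ht : 0 < t) :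
  exists nu : cmeasure R,
    (forall z : R[i], Cplus z ->
        laplace nu z = Cfun t z * bernstein a b mu z) /\
    totvar nu `[0, +oo[ = (2 * rate a b mu t)%:E.
Proof.
case: hg => a0 b0 mu0 muint.
have mint u : 0 < u -> mu.-integrable `]0, +oo[ (fun s => (Num.min s u)%:E).
  by move=> u0; exact: integrable_min.
have sf := sigma_finite_of_integrable_min _ _ mu0 mint.
(* The same measure with its sigma-finiteness recorded, so the conclusion for [smu] is the one for
   [mu]. *)
pose smu : {sigma_finite_measure set R -> \bar R} := HB.pack (Measure.sort mu)
  (isSFinite.Build _ _ _ _ (sfinite_measure_sigma_finite sf))
  (isSigmaFinite.Build _ _ _ _ sf).
exact: (exists_cmeasure R a b smu a0 b0 t ht (mint t ht)).
Qed.
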